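(* Let $a_1,\dots,a_n$ be positive integers, let $X=\mathbf{P}^{a_1}\times\cdots\times\mathbf{P}^{a_n}$, and let $\mathscr{L}=\mathcal{O}_X(\alpha_1,\dots,\alpha_n)$ be an ample line bundle on $X$. Put $N=h^0(X,\mathcal{O}_X(\alpha_1,\dots,\alpha_n))-1$. Let $\alpha,\beta,\gamma$ be positive integers satisfying at least one of the following conditions: (a) $\beta\ge2\gamma+N-1$ and $\beta\ge\alpha+\gamma$; (b) $\beta\ge\alpha+\gamma+N$. Then there exists a linear monad on $X$ of the form $$0\longrightarrow\mathcal{O}_X(-\alpha_1,\dots,-\alpha_n)^{\oplus\alpha}\xrightarrow{\ f\ }\mathcal{O}_X^{\oplus\beta}\xrightarrow{\ g\ }\mathcal{O}_X(\alpha_1,\dots,\alpha_n)^{\oplus\gamma}\longrightarrow0 .$$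
   Context: Varieties are over $\mathbb{C}$. $\mathcal{O}_X(d_1,\dots,d_n)=p_1^*\mathcal{O}_{\mathbf{P}^{a_1}}(d_1)\otimes\cdots\otimes p_n^*\mathcal{O}_{\mathbf{P}^{a_n}}(d_n)$, where $p_i:X\to\mathbf{P}^{a_i}$ is the projection. A monad on a nonsingular projective variety $X$ is a complex of vector bundles $0\to M_0\xrightarrow{a}M_1\xrightarrow{b}M_2\to0$ (so $b\circ a=0$) that is exact at $M_0$ and at $M_2$, i.e. $a$ is injective and $b$ is surjective. For a very ample line bundle $\mathscr{L}$ and finite-dimensional vector spaces $V,W,U$, a linear monad is a monad of the form $0\to V\otimes\mathscr{L}^{-1}\xrightarrow{A}W\otimes\mathcal{O}_X\xrightarrow{B}U\otimes\mathscr{L}\to0$, with $A\in\operatorname{Hom}(V,W)\otimes H^0(\mathscr{L})$ injective and $B\in\operatorname{Hom}(W,U)\otimes H^0(\mathscr{L})$ surjective. *)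

(* Defs.v *)
(* Classical algebraic geometry of the multiprojective space
     X = P^(a_0) x ... x P^(a_(n-1))
   over an algebraically closed field K.  Points of X are handled through their
   homogeneous coordinates: a subset of X is a predicate on coordinate systems
   that is invariant under [same_point], which every Zariski closed or open set
   below is.  A section of O_X(d) over U is the corresponding regular function,
   homogeneous of multidegree d, on the cone over U; the Coq function
   representing it carries no information outside the cone over U, so that
   restriction to a smaller open set does not change the function. *)
From mathcomp Require Import all_boot all_order all_algebra.
From mathcomp Require Import reals complex mpoly.

Set Implicit Arguments.
Unset Strict Implicit.
Unset Printing Implicit Defensive.

Import GRing.Theory.
Local Open Scope ring_scope.

(** ** Points *)

Record hcoords (K : closedFieldType) n (a : 'I_n -> nat) := HCoords {
  hc :> forall i, 'rV[K]_(a i).+1;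
  hc_neq0 : forall i, hc i != 0 }.

Definition same_point (K : closedFieldType) n (a : 'I_n -> nat)
    (x y : hcoords K a) : Prop :=
  forall i, exists2 c : K, c != 0 & y i = c *: x i.

Definition projspace (K : closedFieldType) (k : nat) : Type :=
  hcoords K (fun _ : 'I_1 => k).

(** ** Multihomogeneous polynomials and the Zariski topology *)

(* (i, j) indexes the j-th homogeneous coordinate of the i-th factor *)
Definition cvar n (a : 'I_n -> nat) : finType := {i : 'I_n & 'I_(a i).+1}.

Definition coordring (K : closedFieldType) n (a : 'I_n -> nat) :=
  {mpoly K[#|cvar a|]}.

Definition evalp (K : closedFieldType) n (a : 'I_n -> nat)
    (p : coordring K a) (x : hcoords K a) : K :=
  p.@[fun k => x (tag (enum_val k)) 0 (tagged (enum_val k))].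

Definition mhomog (K : closedFieldType) n (a : 'I_n -> nat)
    (e : 'I_n -> nat) (p : coordring K a) : Prop :=
  forall m, m \in msupp p ->
  forall i, (\sum_(k < #|cvar a| | tag (enum_val k) == i) m k)%N = e i.

Definition zariski_closed (K : closedFieldType) n (a : 'I_n -> nat)
    (Z : hcoords K a -> Prop) : Prop :=
  exists S : coordring K a -> Prop,
    (forall p, S p -> exists e, mhomog e p) /\
    (forall x, Z x <-> forall p, S p -> evalp p x = 0).

Definition zariski_open (K : closedFieldType) n (a : 'I_n -> nat)
    (U : hcoords K a -> Prop) : Prop :=
  exists2 Z, zariski_closed Z & forall x, U x <-> ~ Z x.

(** ** The sheaves O_X(d) and their direct sums *)

(* s is a section of O_X(d) over U *)
Definition is_section (K : closedFieldType) n (a : 'I_n -> nat)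
    (d : 'I_n -> int) (U : hcoords K a -> Prop) (s : hcoords K a -> K) : Prop :=
  forall x, U x ->
  exists (e e' : 'I_n -> nat) (P Q : coordring K a) (V : hcoords K a -> Prop),
    [/\ mhomog e P, mhomog e' Q & forall i, (e i)%:Z - (e' i)%:Z = d i] /\
    [/\ zariski_open V, V x, forall y, V y -> U y
      & forall y, V y -> evalp Q y != 0 /\ s y = evalp P y / evalp Q y].

Definition global_section (K : closedFieldType) n (a : 'I_n -> nat)
    (d : 'I_n -> int) (s : hcoords K a -> K) : Prop :=
  is_section d (fun _ => True) s.

(* h^0(X, O_X(d)) = k *)
Definition is_h0 (K : closedFieldType) n (a : 'I_n -> nat)
    (d : 'I_n -> int) (k : nat) : Prop :=
  exists b : 'I_k -> hcoords K a -> K,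
    [/\ forall i, global_section d (b i),
        forall c : 'I_k -> K,
          (forall x, \sum_i c i * b i x = 0) -> forall i, c i = 0
      & forall s, global_section d s ->
          exists c : 'I_k -> K, forall x, s x = \sum_i c i * b i x].

(* s is a section of O_X(d)^(+r) over U *)
Definition is_vsection (K : closedFieldType) n (a : 'I_n -> nat)
    (d : 'I_n -> int) (r : nat) (U : hcoords K a -> Prop)
    (s : hcoords K a -> 'cV[K]_r) : Prop :=
  forall j, is_section d U (fun x => s x j 0).

(** ** Morphisms O_X(d)^(+r) -> O_X(e)^(+q) and monads *)

(* a family of maps on sections, indexed by subsets of X; only its values on
   open sets matter *)
Definition sheafmap (K : closedFieldType) n (a : 'I_n -> nat) (r q : nat) :=
  (hcoords K a -> Prop) ->
  (hcoords K a -> 'cV[K]_r) -> (hcoords K a -> 'cV[K]_q).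

Definition is_morphism (K : closedFieldType) n (a : 'I_n -> nat)
    (d : 'I_n -> int) (r : nat) (e : 'I_n -> int) (q : nat)
    (F : sheafmap K a r q) : Prop :=
  [/\ forall U s, zariski_open U -> is_vsection d U s -> is_vsection e U (F U s),
      forall U V s t, zariski_open U -> zariski_open V ->
        (forall x, V x -> U x) ->
        is_vsection d U s -> is_vsection d V t ->
        (forall x, V x -> s x = t x) -> forall x, V x -> F U s x = F V t x
    & forall U h s t, zariski_open U -> is_section (fun=> 0) U h ->
        is_vsection d U s -> is_vsection d U t ->
        forall x, U x ->
          F U (fun y => h y *: s y + t y) x = h x *: F U s x + F U t x].

Definition sheaf_injective (K : closedFieldType) n (a : 'I_n -> nat)
    (d : 'I_n -> int) (r q : nat) (F : sheafmap K a r q) : Prop :=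
  forall U s, zariski_open U -> is_vsection d U s ->
    (forall x, U x -> F U s x = 0) -> forall x, U x -> s x = 0.

Definition sheaf_surjective (K : closedFieldType) n (a : 'I_n -> nat)
    (d : 'I_n -> int) (r : nat) (e : 'I_n -> int) (q : nat)
    (F : sheafmap K a r q) : Prop :=
  forall U t, zariski_open U -> is_vsection e U t ->
  forall x, U x ->
  exists (V : hcoords K a -> Prop) s,
    [/\ zariski_open V, V x, forall y, V y -> U y, is_vsection d V s
      & forall y, V y -> F V s y = t y].

(* 0 -> O_X(d0)^(+r0) -F-> O_X(d1)^(+r1) -G-> O_X(d2)^(+r2) -> 0 *)
Definition is_monad (K : closedFieldType) n (a : 'I_n -> nat)
    (d0 : 'I_n -> int) (r0 : nat) (d1 : 'I_n -> int) (r1 : nat)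
    (d2 : 'I_n -> int) (r2 : nat)
    (F : sheafmap K a r0 r1) (G : sheafmap K a r1 r2) : Prop :=
  [/\ is_morphism d0 d1 F, is_morphism d1 d2 G,
      forall U s, zariski_open U -> is_vsection d0 U s ->
        forall x, U x -> G U (F U s) x = 0,
      sheaf_injective d0 F
    & sheaf_surjective d1 d2 G].

(** ** Ampleness *)

(* [phi] is a closed immersion of X into P^k, provided it is a morphism:
   injective with closed image, open onto its image, and such that
   O_(P^k) -> phi_* O_X is surjective.  Continuity holds for the maps given by
   sections of a line bundle, to which this is applied. *)
Definition closed_immersion (K : closedFieldType) n (a : 'I_n -> nat) (k : nat)
    (phi : hcoords K a -> projspace K k) : Prop :=
  [/\ forall x y, same_point (phi x) (phi y) -> same_point x y,
      zariski_closed (fun z : projspace K k => exists x, same_point (phi x) z),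
      forall U : hcoords K a -> Prop, zariski_open U ->
        exists2 V : projspace K k -> Prop,
          zariski_open V & forall x, U x <-> V (phi x)
    & forall (V : projspace K k -> Prop) (h : hcoords K a -> K) z,
        zariski_open V -> is_section (fun=> 0) (fun x => V (phi x)) h -> V z ->
        exists (V' : projspace K k -> Prop) (g : projspace K k -> K),
          [/\ zariski_open V', V' z, forall w, V' w -> V w,
              is_section (fun=> 0) V' g
            & forall x, V' (phi x) -> h x = g (phi x)]].

(* some global sections s_0, ..., s_k of O_X(d) have no common zero and
   phi = [s_0 : ... : s_k] is a closed immersion *)
Definition very_ample (K : closedFieldType) n (a : 'I_n -> nat)
    (d : 'I_n -> int) : Prop :=
  exists (k : nat) (phi : hcoords K a -> projspace K k),
    (forall j, global_section d (fun x => phi x ord0 0 j)) /\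
    closed_immersion phi.

(* the m-th tensor power of O_X(d) is O_X(m d) *)
Definition ample (K : closedFieldType) n (a : 'I_n -> nat)
    (d : 'I_n -> int) : Prop :=
  exists2 m : nat, (0 < m)%N & very_ample K a (fun i => d i *+ m).

(** ** Linear monads *)

Definition mxmap (K : closedFieldType) n (a : 'I_n -> nat) (r q : nat)
    (A : hcoords K a -> 'M[K]_(q, r)) : sheafmap K a r q :=
  fun _ s x => A x *m s x.

(* With L = O_X(d) and V, W, U = K^alpha, K^beta, K^gamma: an element A of
   Hom(V, W) (x) H^0(L) is a matrix of global sections of L. *)
Definition linear_monad (K : closedFieldType) n (a : 'I_n -> nat)
    (d : 'I_n -> int) (alpha beta gamma : nat)
    (A : hcoords K a -> 'M[K]_(beta, alpha))
    (B : hcoords K a -> 'M[K]_(gamma, beta)) : Prop :=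
  [/\ very_ample K a d,
      forall i j, global_section d (fun x => A x i j),
      forall i j, global_section d (fun x => B x i j)
    & is_monad (fun i => - d i) (fun=> 0) d (mxmap A) (mxmap B)].

(* Main.v *)
(* Let x_0, ..., x_N be a basis of H^0(L); it has no common zero.  The Toeplitz
   matrix T with entries T_ij = x_(j-i) is that of the multiplication of
   polynomials by sum_k x_k t^k, hence its rows are independent wherever some
   x_k is nonzero.  When beta >= alpha + gamma + N, the matrix B = [T | 0] with
   gamma + N columns in T leaves room for a block x_0 I_alpha in A.  When
   beta >= 2 gamma + N - 1, use B = [x_0 I | Y], with Y the Toeplitz matrix of
   x_1, ..., x_N, and some columns of A = [-Y; x_0 I].  In both cases A is
   injective because x_0 is nonzero on a dense open subset of the irreducible
   variety X.

   That L is very ample, and not merely ample, follows from the positivity of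
   its multidegree: a section of O(d) with d_i <= 0 is constant along the lines
   of the i-th factor, so that a power of L could not separate points. *)
Require Import Defs.
From mathcomp Require Import all_boot all_order all_algebra.
From mathcomp Require Import reals complex mpoly zify ring.
From Stdlib Require Import Classical.

Set Implicit Arguments.
Unset Strict Implicit.
Unset Printing Implicit Defensive.

Import Order.TTheory GRing.Theory Num.Theory.
Local Open Scope ring_scope.

(** * Multihomogeneous polynomials and their values on coordinates *)

Section Coordinates.
Variables (K : closedFieldType) (n : nat) (a : 'I_n -> nat).
Implicit Types (x y z : hcoords K a) (p q : coordring K a) (e : 'I_n -> nat).

Definition hcoord x (c : cvar a) : K := x (tag c) 0 (tagged c).

Definition var_at i (j : 'I_(a i).+1) : cvar a := Tagged _ j.

Definition coordvar (c : cvar a) : coordring K a := 'X_(enum_rank c).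

Definition degin (m : 'X_{1..#|cvar a|}) (i : 'I_n) : nat :=
  \sum_(k < #|cvar a| | tag (enum_val k) == i) m k.

Lemma reindex_cvar (T : Type) (idx : T) (op : Monoid.com_law idx)
    (P : pred (cvar a)) (F : 'I_#|cvar a| -> T) :
  \big[op/idx]_(k < #|cvar a| | P (enum_val k)) F k =
  \big[op/idx]_(c | P c) F (enum_rank c).
Proof.
rewrite (reindex enum_rank) /=; last first.
  by exists enum_val => c _; rewrite ?enum_rankK ?enum_valK.
by apply: eq_bigl => c; rewrite enum_rankK.
Qed.

Lemma evalpE p x :
  evalp p x =
  \sum_(m <- msupp p) p@_m * \prod_c hcoord x c ^+ m (enum_rank c).
Proof.
rewrite /evalp mevalE; apply: eq_bigr => m _; congr (_ * _).
rewrite (reindex_cvar _ xpredT); apply: eq_bigr => c _.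
by rewrite enum_rankK.
Qed.

Lemma evalpM p q x : evalp (p * q) x = evalp p x * evalp q x.
Proof. exact: mevalM. Qed.

Lemma evalpD p q x : evalp (p + q) x = evalp p x + evalp q x.
Proof. exact: mevalD. Qed.

Lemma evalpB p q x : evalp (p - q) x = evalp p x - evalp q x.
Proof. exact: mevalB. Qed.

Lemma evalpZ (k : K) p x : evalp (k *: p) x = k * evalp p x.
Proof. exact: mevalZ. Qed.

Lemma evalp0 x : evalp (0 : coordring K a) x = 0.
Proof. exact: meval0. Qed.

Lemma evalp1 x : evalp (1 : coordring K a) x = 1.
Proof. exact: meval1. Qed.

Lemma evalp_var c x : evalp (coordvar c) x = hcoord x c.
Proof. by rewrite /evalp mevalXU enum_rankK. Qed.

Lemma evalp_prod (I : Type) (r : seq I) (P : pred I) (F : I -> coordring K a) x :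
  evalp (\prod_(i <- r | P i) F i) x = \prod_(i <- r | P i) evalp (F i) x.
Proof.
elim/big_rec2: _ => [|i f g _ <-]; first exact: evalp1.
by rewrite evalpM.
Qed.

Lemma mhomog_ext e e' p : e =1 e' -> mhomog e p -> mhomog e' p.
Proof. by move=> ee' hp m /hp {}hp i; rewrite hp ee'. Qed.

Lemma mhomog0 e : mhomog e (0 : coordring K a).
Proof. by move=> m; rewrite msupp0. Qed.

Lemma mhomog1 : mhomog (fun=> 0%N) (1 : coordring K a).
Proof.
move=> m; rewrite msupp1 inE => /eqP -> i.
by rewrite big1 // => k _; rewrite mnm0E.
Qed.

Lemma mhomog_var c : mhomog (fun i => (tag c == i) : nat) (coordvar c).
Proof.
move=> m; rewrite msuppX inE => /eqP -> i.
rewrite (reindex_cvar _ (fun c' => tag c' == i)) big_mkcond.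
rewrite (bigD1 c) //= mnm1E eqxx big1 ?addn0; first by case: (_ == i).
move=> c' cc'; rewrite mnm1E (inj_eq enum_rank_inj) [c == _]eq_sym (negPf cc').
by case: ifP.
Qed.

Lemma mhomogD e p q : mhomog e p -> mhomog e q -> mhomog e (p + q).
Proof.
move=> hp hq m /msuppD_le; rewrite mem_cat => /orP[/hp|/hq]; exact.
Qed.

Lemma mhomogZ e (k : K) p : mhomog e p -> mhomog e (k *: p).
Proof. by move=> hp m /msuppZ_le /hp. Qed.

Lemma mhomogB e p q : mhomog e p -> mhomog e q -> mhomog e (p - q).
Proof.
by move=> hp hq; rewrite -scaleN1r; apply: mhomogD => //; apply: mhomogZ.
Qed.

Lemma mhomogM e e' p q :
  mhomog e p -> mhomog e' q -> mhomog (fun i => e i + e' i)%N (p * q).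
Proof.
move=> hp hq m /msuppM_le /allpairsP[[m1 m2] /= [/hp h1 /hq h2 ->]] i.
by rewrite -(h1 i) -(h2 i) -big_split; apply: eq_bigr => k _; rewrite mnmDE.
Qed.

Lemma mhomog_prod (I : Type) (r : seq I) (F : I -> coordring K a)
    (f : I -> 'I_n -> nat) :
  (forall i, mhomog (f i) (F i)) ->
  mhomog (fun j => \sum_(i <- r) f i j)%N (\prod_(i <- r) F i).
Proof.
move=> hF; elim: r => [|i r IHr].
  by rewrite big_nil; apply: mhomog_ext mhomog1 => j; rewrite big_nil.
rewrite big_cons; apply: mhomog_ext (mhomogM (hF i) IHr) => j.
by rewrite big_cons.
Qed.

Lemma mhomogX e p r : mhomog e p -> mhomog (fun i => r * e i)%N (p ^+ r).
Proof.
move=> hp; elim: r => [|r IHr]; first exact: mhomog1.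
by rewrite exprS; apply: mhomog_ext (mhomogM hp IHr) => i; rewrite mulSn.
Qed.

(** Each monomial of [p] scales by the product of the [c i] raised to its degree in the i-th factor,
    which is [e i] for all of them; the variables are grouped by factor. *)
Lemma evalp_scale e p x y (c : 'I_n -> K) :
  mhomog e p -> (forall i, y i = c i *: x i) ->
  evalp p y = (\prod_i c i ^+ e i) * evalp p x.
Proof.
move=> hp yx; rewrite !evalpE mulr_sumr big_seq [RHS]big_seq.
apply: eq_bigr => m /hp hm; rewrite mulrCA; congr (_ * _).
have -> : \prod_i c i ^+ e i =
    \prod_(v : cvar a) c (tag v) ^+ m (enum_rank v).
  rewrite (partition_big (fun v : cvar a => tag v) xpredT) //=.
  apply: eq_bigr => i _; rewrite -(hm i).
  rewrite (reindex_cvar _ (fun v => tag v == i)) -prodrXr.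
  by apply: eq_bigr => v /eqP ->.
rewrite -big_split; apply: eq_bigr => v _ /=.
by rewrite /hcoord yx mxE exprMn.
Qed.

Lemma evalp_same_point e p x y :
  mhomog e p -> same_point x y -> evalp p x != 0 -> evalp p y != 0.
Proof.
move=> hp xy px0.
(* Quotients of coordinates turn the existential scalars of [same_point] into a function of [i]. The
   default 0 is never reached, since [x i] is nonzero. *)
pose c i := if [pick j | x i 0 j != 0] is Some j then y i 0 j / x i 0 j else 0.
have c_neq0 i : c i != 0 /\ y i = c i *: x i.
  have [k k0 yk] := xy i; rewrite /c; case: pickP => [j xj|x0].
    by rewrite yk mxE mulfK.
  case/negP: (hc_neq0 x i); apply/eqP/rowP => j; rewrite mxE.
  by apply/eqP; apply: contraFT (x0 j).
rewrite (evalp_scale hp (fun i => (c_neq0 i).2)) mulf_neq0 //.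
by apply/prodf_neq0 => i _; rewrite expf_neq0 ?(c_neq0 i).1.
Qed.

Lemma hcoords_coord_neq0 x i : exists j, x i 0 j != 0.
Proof.
have [j /= xj|x0] := pickP (fun j => x i 0 j != 0); first by exists j.
case/negP: (hc_neq0 x i); apply/eqP/rowP => j; rewrite mxE.
by apply/eqP; apply: contraFT (x0 j).
Qed.

End Coordinates.

(** * Zariski topology and irreducibility *)

Section ZariskiTopology.
Variables (K : closedFieldType) (n : nat) (a : 'I_n -> nat).
Implicit Types (x y z : hcoords K a) (p q : coordring K a) (e : 'I_n -> nat).
Implicit Types (U V : hcoords K a -> Prop).

Lemma closed_witness (Z : hcoords K a -> Prop) (S : coordring K a -> Prop) x :
  (forall x, Z x <-> forall p, S p -> evalp p x = 0) -> ~ Z x ->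
  exists2 p, S p & evalp p x != 0.
Proof.
move=> ZS Zx; apply: NNPP => noP; apply: Zx; apply/ZS => p Sp.
by apply: NNPP => px; apply: noP; exists p => //; apply/eqP.
Qed.

(** An equation of the complement that fails at [x] cuts out a principal neighbourhood. Local
    arguments reduce to such neighbourhoods. *)
Lemma open_basic U x : zariski_open U -> U x ->
  exists e p, [/\ mhomog e p, evalp p x != 0 & forall y, evalp p y != 0 -> U y].
Proof.
move=> [Z [S [homS ZS]] UZ] /UZ Zx.
have [p Sp px] := closed_witness ZS Zx.
have [e hp] := homS p Sp; exists e, p; split=> //.
by move=> y py; apply/UZ => /ZS /(_ p Sp) py0; rewrite py0 eqxx in py.
Qed.

Lemma open_ne0 e p : mhomog e p -> zariski_open (fun x => evalp p x != 0).
Proof.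
move=> hp; exists (fun x => evalp p x = 0); last first.
  by move=> x; split=> [/eqP|/eqP].
exists (eq p); split; first by move=> _ <-; exists e.
by move=> x; split=> [px _ <-|]; last exact.
Qed.

Lemma openT : zariski_open (fun=> True : Prop) (K := K) (a := a).
Proof.
exists (fun=> False); last by move=> x; tauto.
exists (eq 1); split.
  by move=> _ <-; exists (fun=> 0%N); apply: mhomog1.
move=> x; split=> // /(_ _ erefl); rewrite evalp1 => /eqP.
by rewrite oner_eq0.
Qed.

Lemma openI U V :
  zariski_open U -> zariski_open V -> zariski_open (fun x => U x /\ V x).
Proof.
move=> [Z [S [homS ZS]] UZ] [Y [T [homT YT]] VY].
exists (fun x => Z x \/ Y x); last by move=> x; rewrite UZ VY; tauto.
exists (fun r => exists p q, [/\ S p, T q & r = p * q]); split.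
  move=> _ [p [q [/homS[e hp] /homT[e' hq] ->]]].
  by exists (fun i => e i + e' i)%N; apply: mhomogM.
move=> x; split=> [ZY _ [p [q [Sp Tq ->]]]|ST0].
  rewrite evalpM; case: ZY => [/ZS/(_ p Sp)->|/YT/(_ q Tq)->]; first by rewrite mul0r.
  by rewrite mulr0.
apply: NNPP => /not_or_and[/(closed_witness ZS)[p Sp px]].
move=> /(closed_witness YT)[q Tq qx].
have /eqP := ST0 (p * q) (ex_intro _ p (ex_intro _ q (And3 Sp Tq erefl))).
by rewrite evalpM mulf_eq0 (negPf px) (negPf qx).
Qed.

Lemma open_same_point U x y : zariski_open U -> same_point x y -> U x -> U y.
Proof.
move=> oU xy /(open_basic oU)[e [p [hp px pU]]].
exact/pU/(evalp_same_point hp xy).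
Qed.

(* [h] gives the coordinates of a polynomial curve through the cone over X. *)
Definition curve_poly (h : cvar a -> {poly K}) (p : coordring K a) : {poly K} :=
  \sum_(m <- msupp p) p@_m *: \prod_c h c ^+ m (enum_rank c).

Lemma horner_curve_poly h p x t : (forall c, hcoord x c = (h c).[t]) ->
  (curve_poly h p).[t] = evalp p x.
Proof.
move=> xh; rewrite evalpE horner_sum; apply: eq_bigr => m _.
rewrite hornerZ horner_prod; congr (_ * _); apply: eq_bigr => c _.
by rewrite horner_exp xh.
Qed.

(* Irreducibility of X, by restriction to the line joining [x] and [z]. *)
Lemma ne0_meet p q x z : evalp p x != 0 -> evalp q z != 0 ->
  exists y, evalp p y != 0 /\ evalp q y != 0.
Proof.
move=> px qz.
pose h c := (hcoord x c)%:P + (hcoord z c - hcoord x c) *: 'X.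
have h0 c : hcoord x c = (h c).[0].
  by rewrite hornerD hornerC hornerZ hornerX mulr0 addr0.
have h1 c : hcoord z c = (h c).[1].
  by rewrite hornerD hornerC hornerZ hornerX mulr1 addrC subrK.
have j i : {j | x i 0 j != 0} by apply/sigW/hcoords_coord_neq0.
(* The last product keeps the point of the line inside X: in each factor it contains a coordinate
   that is nonzero at [x], so a parameter outside the roots of [r] gives nonzero vectors in all
   factors. *)
pose r := curve_poly h p * curve_poly h q *
  \prod_i h (var_at (sval (j i))).
have : r != 0.
  rewrite !mulf_neq0 //.
  - by apply: contraNneq px => p0; rewrite -(horner_curve_poly p h0) p0 horner0.
  - by apply: contraNneq qz => q0; rewrite -(horner_curve_poly q h1) q0 horner0.
  apply/prodf_neq0 => i _; apply: contraNneq (svalP (j i)) => hi0.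
  by rewrite -[_ 0 _]/(hcoord x (var_at (sval (j i)))) h0 hi0 horner0.
case/closed_nonrootP => t; rewrite rootE !hornerM !mulf_eq0 !negb_or.
case/andP=> /andP[pt qt]; rewrite horner_prod => /prodf_neq0 ht.
pose y0 i : 'rV[K]_(a i).+1 :=
  \row_k (h (var_at k)).[t].
have y0P i : y0 i != 0.
  have := ht i isT; apply: contraNneq => /rowP/(_ (sval (j i))).
  by rewrite !mxE => ->.
pose y := HCoords y0P.
have yh c : hcoord y c = (h c).[t].
  by case: c => i k; rewrite /hcoord mxE.
by exists y; rewrite -!(horner_curve_poly _ yh).
Qed.

End ZariskiTopology.

(** * Algebra of sections of line bundles *)

Section Sections.
Variables (K : closedFieldType) (n : nat) (a : 'I_n -> nat).
Implicit Types (x y z : hcoords K a) (p q : coordring K a) (e : 'I_n -> nat).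
Implicit Types (d : 'I_n -> int) (U V : hcoords K a -> Prop).
Implicit Types (s t : hcoords K a -> K).

(** Each factor has a coordinate that does not vanish at [x]; multiply suitable powers of these. *)
Lemma ne0_monomial e x : exists2 p, mhomog e p & evalp p x != 0.
Proof.
have j i : {j | x i 0 j != 0} by apply/sigW/hcoords_coord_neq0.
pose X i : coordring K a :=
  coordvar K (var_at (sval (j i))).
exists (\prod_i X i ^+ e i).
  have hX i : mhomog (fun k => e i * (i == k))%N (X i ^+ e i).
    exact/mhomogX/mhomog_var.
  apply: mhomog_ext (mhomog_prod hX) => k.
  rewrite (bigD1 k) //= eqxx muln1 big1 ?addn0 // => i /negPf ->.
  by rewrite muln0.
rewrite evalp_prod; apply/prodf_neq0 => i _.
have := svalP (j i); rewrite -[_ 0 _]/(hcoord x (var_at (sval (j i)))).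
rewrite -evalp_var -/(X i); elim: (e i) => [|k IHk] Xx.
  by rewrite expr0 evalp1 oner_neq0.
by rewrite exprS evalpM mulf_neq0 // IHk.
Qed.

Lemma section_local d U s x : is_section d U s -> U x ->
  exists e e' f P Q p,
    [/\ mhomog e P, mhomog e' Q, mhomog f p & forall i, (e i)%:Z - (e' i)%:Z = d i]
    /\ evalp p x != 0
    /\ forall y, evalp p y != 0 ->
         [/\ U y, evalp Q y != 0 & s y = evalp P y / evalp Q y].
Proof.
move=> sU /sU[e [e' [P [Q [V [[hP hQ ee'] [oV Vx VU sV]]]]]]].
have [f [p [hp px pV]]] := open_basic oV Vx.
exists e, e', f, P, Q, p; split; first by split.
by split=> // y /pV Vy; have [Qy sy] := sV y Vy; split=> //; apply: VU.
Qed.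

Lemma section_ext d d' U s t : d =1 d' -> (forall x, U x -> s x = t x) ->
  is_section d U s -> is_section d' U t.
Proof.
move=> dd' st sU x Ux.
have [e [e' [P [Q [V [[hP hQ ee'] [oV Vx VU sV]]]]]]] := sU x Ux.
exists e, e', P, Q, V; split; first by split=> // i; rewrite -dd'.
by split=> // y Vy; have [Qy sy] := sV y Vy; split=> //; rewrite -st //; apply: VU.
Qed.

Lemma section_restrict d U V s : zariski_open V -> (forall x, V x -> U x) ->
  is_section d U s -> is_section d V s.
Proof.
move=> oV VU sU x Vx.
have [e [e' [P [Q [W [[hP hQ ee'] [oW Wx WU sW]]]]]]] := sU x (VU x Vx).
exists e, e', P, Q, (fun y => W y /\ V y); split; first by split.
by split=> [|//|y []//|y [/sW]]; first exact: openI.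
Qed.

Lemma section_poly e p U : zariski_open U -> mhomog e p ->
  is_section (fun i => (e i)%:Z) U (evalp p).
Proof.
move=> oU hp x Ux; exists e, (fun=> 0%N), p, 1, U; split.
  by split=> [//||i]; [apply: mhomog1 | rewrite subr0].
by split=> // y _; rewrite evalp1 oner_neq0 divr1.
Qed.

Lemma section_const U (k : K) : zariski_open U -> is_section (fun=> 0) U (fun=> k).
Proof.
move=> oU; have h1 := mhomogZ (k := k) (@mhomog1 K n a).
apply: section_ext (section_poly oU h1) => //.
by move=> x _; rewrite evalpZ evalp1 mulr1.
Qed.

Lemma section0 d U : zariski_open U -> is_section d U (fun=> 0).
Proof.
move=> oU x Ux.
(* Zero must still be a fraction of multidegree [d]: the positive part of [d] goes to the numerator
   0, the negative part to a monomial denominator that is nonzero at [x]. *)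
pose e i := if d i is Posz k then k else 0%N.
pose e' i := if d i is Negz k then k.+1 else 0%N.
have [Q hQ Qx] := ne0_monomial e' x.
exists e, e', 0, Q, (fun y => U y /\ evalp Q y != 0); split.
  split=> // [|i]; first exact: mhomog0.
  by rewrite /e /e'; case: (d i) => k; rewrite ?subr0 // NegzE sub0r.
split=> // [|y []//|y [_ Qy]]; first exact/openI/(open_ne0 hQ).
by rewrite evalp0 mul0r.
Qed.

Lemma sectionD d U s t :
  is_section d U s -> is_section d U t -> is_section d U (fun x => s x + t x).
Proof.
move=> sU tU x Ux.
have [e [e' [P [Q [V [[hP hQ ee'] [oV Vx VU sV]]]]]]] := sU x Ux.
have [f [f' [P1 [Q1 [W [[hP1 hQ1 ff'] [oW Wx WU tW]]]]]]] := tU x Ux.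
exists (fun i => e i + f' i)%N, (fun i => e' i + f' i)%N.
exists (P * Q1 + P1 * Q), (Q * Q1).
exists (fun y => V y /\ W y); split.
  split=> [||i]; [apply: mhomogD | exact: mhomogM |]; first exact: mhomogM.
    by apply: mhomog_ext (mhomogM hP1 hQ) => i; have := ee' i; have := ff' i; lia.
  by have := ee' i; lia.
split=> [|//|y [/VU]//|y [/sV[Qy ->] /tW[Q1y ->]]]; first exact: openI.
by rewrite evalpD !evalpM mulf_neq0 // addf_div.
Qed.

Lemma sectionM d d' U s t : is_section d U s -> is_section d' U t ->
  is_section (fun i => d i + d' i) U (fun x => s x * t x).
Proof.
move=> sU tU x Ux.
have [e [e' [P [Q [V [[hP hQ ee'] [oV Vx VU sV]]]]]]] := sU x Ux.
have [f [f' [P1 [Q1 [W [[hP1 hQ1 ff'] [oW Wx WU tW]]]]]]] := tU x Ux.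
exists (fun i => e i + f i)%N, (fun i => e' i + f' i)%N, (P * P1), (Q * Q1).
exists (fun y => V y /\ W y); split.
  split=> [||i]; [exact: mhomogM | exact: mhomogM |].
  by rewrite !PoszD opprD addrACA ee' ff'.
split=> [|//|y [/VU]//|y [/sV[Qy ->] /tW[Q1y ->]]]; first exact: openI.
by rewrite !evalpM mulf_neq0 // mulf_div.
Qed.

Lemma sectionV d U s : is_section d U s -> (forall x, U x -> s x != 0) ->
  is_section (fun i => - d i) U (fun x => (s x)^-1).
Proof.
move=> sU s0 x Ux.
have [e [e' [P [Q [V [[hP hQ ee'] [oV Vx VU sV]]]]]]] := sU x Ux.
exists e', e, Q, P, V; split; first by split=> // i; rewrite -ee' opprB.
split=> // y Vy; have [Qy sy] := sV y Vy.
have := s0 y (VU y Vy); rewrite sy mulf_eq0 invr_eq0 negb_or => /andP[Py _].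
by rewrite invf_div.
Qed.

Lemma section_sum d U (I : Type) (r : seq I) (F : I -> hcoords K a -> K) :
  zariski_open U -> (forall i, is_section d U (F i)) ->
  is_section d U (fun x => \sum_(i <- r) F i x).
Proof.
move=> oU FU; elim: r => [|i r IHr].
  by apply: section_ext (section0 d oU) => // x _; rewrite big_nil.
by apply: section_ext (sectionD (FU i) IHr) => // x _; rewrite big_cons.
Qed.

Lemma section0M d U s t : is_section (fun=> 0) U s -> is_section d U t ->
  is_section d U (fun x => s x * t x).
Proof.
by move=> sU tU; apply: section_ext (sectionM sU tU) => // i; rewrite add0r.
Qed.

Lemma section0_prod U (I : Type) (r : seq I) (F : I -> hcoords K a -> K) :
  zariski_open U -> (forall i, is_section (fun=> 0) U (F i)) ->
  is_section (fun=> 0) U (fun x => \prod_(i <- r) F i x).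
Proof.
move=> oU FU; elim: r => [|i r IHr].
  by apply: section_ext (section_const 1 oU) => // x _; rewrite big_nil.
by apply: section_ext (section0M (FU i) IHr) => // x _; rewrite big_cons.
Qed.

Lemma section0_det U m (M : hcoords K a -> 'M[K]_m) : zariski_open U ->
  (forall i j, is_section (fun=> 0) U (fun x => M x i j)) ->
  is_section (fun=> 0) U (fun x => \det (M x)).
Proof.
move=> oU MU; apply: section_sum => // sigma.
by apply: section0M; [exact: section_const | exact: section0_prod].
Qed.

Lemma section0_adj U m (M : hcoords K a -> 'M[K]_m) i j : zariski_open U ->
  (forall i j, is_section (fun=> 0) U (fun x => M x i j)) ->
  is_section (fun=> 0) U (fun x => (\adj (M x)) i j).
Proof.
move=> oU MU.
apply: (@section_ext (fun=> 0) _ U (fun x => cofactor (M x) j i)) => //.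
  by move=> x _; rewrite mxE.
apply: section0M; first exact: section_const.
apply: section0_det => // k l.
by apply: section_ext (MU (lift j k) (lift i l)) => // x _; rewrite !mxE.
Qed.

Lemma section_ne0_nbhd d U s x : zariski_open U -> is_section d U s ->
  U x -> s x != 0 ->
  exists V, [/\ zariski_open V, V x, forall y, V y -> U y
              & forall y, V y -> s y != 0].
Proof.
move=> oU sU Ux sx.
have [e [e' [f [P [Q [p [[hP hQ hp _] [px pU]]]]]]]] := section_local sU Ux.
exists (fun y => evalp p y != 0 /\ evalp P y != 0); split.
- by apply: openI; [exact: open_ne0 hp | exact: open_ne0 hP].
- split=> //; have [_ _ sPQ] := pU x px.
  by move: sx; rewrite sPQ mulf_eq0 negb_or => /andP[].
- by move=> y [/pU[]].
by move=> y [/pU[_ Qy ->] Py]; rewrite mulf_neq0 ?invr_neq0.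
Qed.

(** Irreducibility of X in terms of sections: [ne0_meet] is applied to the local numerators, each
    multiplied by the equation of the principal open set on which its fraction is valid. *)
Lemma section_ne0_meet d d' U V s t x z :
  is_section d U s -> is_section d' V t ->
  U x -> V z -> s x != 0 -> t z != 0 ->
  exists y, [/\ U y, V y, s y != 0 & t y != 0].
Proof.
move=> sU tV Ux Vz sx tz.
have [e [e' [f [P [Q [p [_ [px pU]]]]]]]] := section_local sU Ux.
have [e1 [e1' [f1 [P1 [Q1 [p1 [_ [p1z p1V]]]]]]]] := section_local tV Vz.
have [_ _ sPQ] := pU x px; have [_ _ tPQ] := p1V z p1z.
move: sx tz; rewrite sPQ tPQ !mulf_eq0 !negb_or => /andP[Px _] /andP[P1z _].
have pPx : evalp (p * P) x != 0 by rewrite evalpM mulf_neq0.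
have pPz : evalp (p1 * P1) z != 0 by rewrite evalpM mulf_neq0.
have [y []] := ne0_meet pPx pPz.
rewrite !evalpM !mulf_eq0 !negb_or => /andP[/pU[Uy Qy sy] Py].
move=> /andP[/p1V[Vy Q1y ty] P1y].
by exists y; split; rewrite // (sy, ty) mulf_neq0 ?invr_neq0.
Qed.

End Sections.

(** * Morphisms given by matrices of sections *)

Section MatrixMorphisms.
Variables (K : closedFieldType) (n : nat) (a : 'I_n -> nat) (d : 'I_n -> int).

Lemma mulmx_section e r q U (A : hcoords K a -> 'M[K]_(q, r))
    (s : hcoords K a -> 'cV[K]_r) :
  zariski_open U -> (forall i j, global_section d (fun x => A x i j)) ->
  is_vsection e U s -> is_vsection (fun i => d i + e i) U (fun x => A x *m s x).
Proof.
move=> oU As sU i.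
apply: (@section_ext _ _ _ (fun i => d i + e i) _ _
  (fun x => \sum_j A x i j * s x j 0)) => //.
  by move=> x _; rewrite mxE.
apply: section_sum => // j; apply: sectionM (sU j).
exact: section_restrict (As i j).
Qed.

Lemma mxmap_morphism e e' r q (A : hcoords K a -> 'M[K]_(q, r)) :
  (forall i, d i + e i = e' i) ->
  (forall i j, global_section d (fun x => A x i j)) ->
  is_morphism e e' (mxmap A).
Proof.
move=> ee' As; split=> [U s oU sU i|U V s t oU oV VU sU tV st x Vx|].
- by apply: section_ext (mulmx_section oU As sU i).
- by rewrite /mxmap st.
by move=> U h s t oU hU sU tU x Ux; rewrite /mxmap mulmxDr scalemxAr.
Qed.

(** A section in the kernel vanishes wherever [s0] does not. If one of its components were nonzero
    somewhere, irreducibility would give a point where it and [s0] are both nonzero. *)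
Lemma mxmap_injective e r q (A : hcoords K a -> 'M[K]_(q, r))
    (s0 : hcoords K a -> K) z :
  global_section d s0 -> s0 z != 0 ->
  (forall x (v : 'cV_r), A x *m v = 0 -> s0 x *: v = 0) ->
  sheaf_injective e (mxmap A).
Proof.
move=> s0s s0z Ainj U s oU sU As0 x Ux; apply/colP => j; rewrite mxE.
apply/eqP/negPn/negP => sx.
have [y [Uy _ sy s0y]] := section_ne0_meet (sU j) s0s Ux I sx s0z.
have /eqP := Ainj y (s y) (As0 y Uy).
by rewrite scaler_eq0 (negPf s0y) => /eqP sy0; rewrite sy0 mxE eqxx in sy.
Qed.

(** Cramer's rule near [x]: a right inverse [C] of [B x], kept constant, makes [B y *m C] invertible
    for [y] near [x], and the adjugate expresses the inverse through regular functions. *)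
Lemma mxmap_surjective r q (B : hcoords K a -> 'M[K]_(q, r)) :
  (forall i j, global_section d (fun x => B x i j)) ->
  (forall x, row_free (B x)) ->
  sheaf_surjective (fun=> 0) d (mxmap B).
Proof.
(* The target is zero when [q = 0]; otherwise a first diagonal entry is available below. *)
case: q B => [|q] B Bs Bfree U t oU tU x Ux.
  exists U, (fun=> 0); split=> // [j|y _].
    by apply: section_ext (section0 _ oU) => // y _; rewrite mxE.
  by apply/colP; case.
have [C BC] := row_freeP (Bfree x).
have BCs i j : global_section d (fun y => (B y *m C) i j).
  apply: (@section_ext _ _ _ d _ _ (fun y => \sum_k C k j * B y i k)) => //.
    by move=> y _; rewrite mxE; apply: eq_bigr => k _; rewrite mulrC.
  apply: section_sum; first exact: openT.
  by move=> k; apply: section0M (Bs i k); apply/section_const/openT.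
(* As [B x *m C] is the identity, [c] is a section of O(d) that is nonzero near [x]. Dividing by it
   trivialises O(d), so that the entries of [M] are regular functions. *)
pose c y := (B y *m C) 0 0.
have cU : is_section d U c by apply: section_restrict (BCs 0 0).
have cx : c x != 0 by rewrite /c BC mxE eqxx oner_neq0.
have [V [oV Vx VU c0]] := section_ne0_nbhd oU cU Ux cx.
have cVs := sectionV (section_restrict oV VU cU) c0.
pose M y := (c y)^-1 *: (B y *m C).
have Ms i j : is_section (fun=> 0) V (fun y => M y i j).
  apply: (@section_ext _ _ _ (fun i => - d i + d i) _ _
    (fun y => (c y)^-1 * (B y *m C) i j)).
  - by move=> k; rewrite addNr.
  - by move=> y _; rewrite [RHS]mxE.
  by apply: sectionM cVs _; apply: section_restrict (BCs i j).
have Mx : \det (M x) != 0.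
  by rewrite /M BC detZ det1 mulr1 expf_neq0 // invr_neq0.
have [W [oW Wx WV det0]] :=
  section_ne0_nbhd oV (section0_det oV Ms) Vx Mx.
have MsW i j := section_restrict oW WV (Ms i j).
pose s y := (c y)^-1 *: (C *m ((\det (M y))^-1 *: (\adj (M y) *m t y))).
exists W, s; split=> // [y /WV/VU//|j|y Wy]; last first.
  rewrite /mxmap /s -scalemxAr mulmxA scalemxAl -/(M y) -scalemxAr mulmxA.
  rewrite mul_mx_adj mul_scalar_mx scalerA mulVf ?scale1r //.
  exact: det0.
apply: (@section_ext _ _ _ (fun i => - d i + d i) _ _ (fun y => (c y)^-1 *
    \sum_k C j k * ((\det (M y))^-1 *
      \sum_l (\adj (M y)) k l * t y l 0))).
- by move=> k; rewrite addNr.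
- move=> y _; rewrite !mxE; congr (_ * _); apply: eq_bigr => k _.
  by rewrite !mxE.
apply: sectionM (section_restrict oW WV cVs) _.
apply: section_sum => // k.
apply: section0M; first exact: section_const.
apply: section0M.
  by apply: section_ext (sectionV (section0_det oW MsW) det0).
apply: section_sum => // l.
apply: section0M; first exact: section0_adj.
by apply: section_restrict (tU l) => // y /WV/VU.
Qed.

End MatrixMorphisms.

(** * Polynomials in one variable with a formal degree *)

Section LeadingTerm.
Variable K : closedFieldType.
Implicit Types p q : {poly K}.

(** The coefficient [v] may be zero: it is the value at infinity of [p] seen as a binary form of
    degree [k]. *)
Definition degree_top (k : nat) (v : K) p := (size p <= k.+1)%N /\ p`_k = v.

Lemma degree_topM k l u v p q :
  degree_top k u p -> degree_top l v q -> degree_top (k + l) (u * v) (p * q).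
Proof.
move=> [sp <-] [sq <-]; split.
  by apply: leq_trans (size_polyMleq _ _) _; lia.
rewrite coefM (bigD1 (Ordinal (leq_addr l k : (k < (k + l).+1)%N))) //=.
rewrite addKn big1 ?addr0 // => i ik.
have [ltik|] := ltnP i k.
  by rewrite [q`__]nth_default ?mulr0 //; apply: leq_trans sq _; lia.
rewrite leq_eqVlt => /predU1P[ki|ltki].
  by case/eqP: ik; apply/val_inj.
by rewrite nth_default ?mul0r //; apply: leq_trans sp _.
Qed.

Lemma degree_top1 : degree_top 0 1 1.
Proof. by split; rewrite ?size_poly1 ?coef1. Qed.

Lemma degree_top_exp k u p m :
  degree_top k u p -> degree_top (m * k) (u ^+ m) (p ^+ m).
Proof.
move=> pu; elim: m => [|m IHm]; first exact: degree_top1.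
by rewrite !exprS mulSn; apply: degree_topM.
Qed.

Lemma degree_top_prod (I : Type) (r : seq I) (k : I -> nat) (u : I -> K)
    (F : I -> {poly K}) :
  (forall i, degree_top (k i) (u i) (F i)) ->
  degree_top (\sum_(i <- r) k i) (\prod_(i <- r) u i) (\prod_(i <- r) F i).
Proof.
move=> Fu; elim: r => [|i r IHr]; first by rewrite !big_nil; apply: degree_top1.
by rewrite !big_cons; apply: degree_topM.
Qed.

Lemma degree_top_sum (I : eqType) (r : seq I) (k : nat) (u : I -> K)
    (F : I -> {poly K}) :
  (forall i, i \in r -> degree_top k (u i) (F i)) ->
  degree_top k (\sum_(i <- r) u i) (\sum_(i <- r) F i).
Proof.
move=> Fu; split; last first.
  by rewrite coef_sum; apply: eq_big_seq => i /Fu[].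
rewrite big_seq; elim/big_rec: _ => [|i p /Fu[sF _] sp]; first by rewrite size_poly0.
by apply: leq_trans (size_polyD _ _) _; rewrite geq_max sF.
Qed.

Lemma eq_poly_away (r p q : {poly K}) : r != 0 ->
  (forall t, r.[t] != 0 -> p.[t] = q.[t]) -> p = q.
Proof.
move=> r0 pq; apply/eqP; rewrite -subr_eq0; apply/negPn/negP => pq0.
have /closed_nonrootP[t] : r * (p - q) != 0 by rewrite mulf_neq0.
rewrite rootE hornerM mulf_eq0 negb_or => /andP[/pq pqt].
by rewrite hornerD hornerN pqt subrr eqxx.
Qed.

(* The rational function A/B = P/Q has no pole. *)
Lemma regular_fraction_dvdp (A B : {poly K}) : B != 0 ->
  (forall t, exists P Q : {poly K}, Q.[t] != 0 /\ A * Q = P * B) -> B %| A.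
Proof.
move=> B0 AB; set g := gcdp A B.
have g0 : g != 0 by rewrite gcdp_eq0 (negPf B0) andbF.
have [A1 A1E] : exists A1, A = A1 * g.
  by exists (A %/ g); rewrite divpK ?dvdp_gcdl.
have [B1 B1E] : exists B1, B = B1 * g.
  by exists (B %/ g); rewrite divpK ?dvdp_gcdr.
have copAB : coprimep B1 A1.
  have := coprimep_div_gcd (p := A) (q := B).
  rewrite B0 orbT => /(_ isT); rewrite -/g {1}A1E {1}B1E !mulpK //.
  by rewrite coprimep_sym.
(* Once the gcd is cancelled, [B1] divides every local denominator [Q], so it has no root and is
   constant. *)
suff sB1 : size B1 == 1%N.
  rewrite A1E B1E dvdp_mul2r //; apply: dvdp_trans (dvd1p _).
  by rewrite dvdp1.
apply: contraT => /closed_rootP[t B1t].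
have [P [Q [Qt]]] := AB t.
rewrite A1E B1E mulrAC mulrA => /(mulIf g0) A1Q.
have : B1 %| Q by rewrite -(Gauss_dvdpr _ copAB) A1Q dvdp_mull.
by move/dvdpP=> [C QE]; rewrite QE hornerM (rootP B1t) mulr0 eqxx in Qt.
Qed.

End LeadingTerm.

(** * Sections of nonpositive degree along a line *)

Section NonpositiveDegree.
Variables (K : closedFieldType) (n : nat) (a : 'I_n -> nat) (i0 : 'I_n).

(** The curve [h] is linear in the coordinates of the factor [i0] and constant in the others, with
    [xoo] as its point at infinity. A monomial therefore gets its degree in the factor [i0] as
    formal degree, and its value at [xoo] as top coefficient. *)
Lemma curve_poly_top (h : cvar a -> {poly K}) (xoo : hcoords K a) e p :
  (forall c, degree_top (tag c == i0) (hcoord xoo c) (h c)) ->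
  mhomog e p -> degree_top (e i0) (evalp p xoo) (curve_poly h p).
Proof.
move=> hoo hp; rewrite evalpE; apply: degree_top_sum => m /hp hm.
have := degree_top_prod (index_enum (cvar a))
  (fun c => degree_top_exp (m (enum_rank c)) (hoo c)).
rewrite -(hm i0) (reindex_cvar _ (fun c => tag c == i0)) [in X in _ -> X]big_mkcond.
rewrite (eq_bigr (fun c : cvar a => if tag c == i0 then m (enum_rank c) else 0%N)).
  move=> htop; rewrite -mul_polyC -[X in degree_top X]add0n.
  by apply: degree_topM htop; split; rewrite ?size_polyC_leq1 ?coefC.
by move=> c _; case: eqP; rewrite ?muln1 ?muln0.
Qed.

(** The fraction [A / B] representing [s] near infinity has no pole at finite parameters, so it is a
    polynomial [C]. Since [Q] is nonzero at [xoo], [B] has degree exactly [e' i0], while [A] has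
    degree at most [e i0 <= e' i0]; hence [C] is constant. *)
Lemma section_curve_const (h : cvar a -> {poly K}) (x : K -> hcoords K a)
    (xoo : hcoords K a) d s :
  (forall t c, hcoord (x t) c = (h c).[t]) ->
  (forall c, degree_top (tag c == i0) (hcoord xoo c) (h c)) ->
  global_section d s -> (d i0 <= 0)%R -> exists c, forall t, s (x t) = c.
Proof.
move=> hx hoo sd d0.
have [e [e' [f [P [Q [p [[hP hQ hp ee'] [pxoo pU]]]]]]]] :=
  section_local sd (I : (fun=> True) xoo).
have [_ Qoo _] := pU xoo pxoo.
set A := curve_poly h P; set B := curve_poly h Q; set r := curve_poly h p.
have [sA _] := curve_poly_top hoo hP; rewrite -/A in sA.
have [sB Btop] := curve_poly_top hoo hQ; rewrite -/B in sB Btop.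
have [_ rtop] := curve_poly_top hoo hp; rewrite -/r in rtop.
have B0 : B != 0 by apply: contraNneq Qoo => B0; rewrite -Btop B0 coef0.
have r0 : r != 0 by apply: contraNneq pxoo => r0; rewrite -rtop r0 coef0.
have sAB t : r.[t] != 0 -> A.[t] = s (x t) * B.[t].
  rewrite !(horner_curve_poly _ (hx t)) => /pU[_ Qt ->].
  by rewrite divfK.
(* The fraction that represents [s] near the parameter [t] agrees with [A / B] outside finitely many
   parameters, hence as a rational function. *)
have loc t : exists P1 Q1 : {poly K},
    [/\ Q1.[t] != 0, A * Q1 = P1 * B & s (x t) = P1.[t] / Q1.[t]].
  have [e1 [e1' [f1 [P1 [Q1 [p1 [_ [p1t p1U]]]]]]]] :=
    section_local sd (I : (fun=> True) (x t)).
  have [_ Q1t st] := p1U _ p1t.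
  exists (curve_poly h P1), (curve_poly h Q1).
  rewrite !(horner_curve_poly _ (hx t)); split=> //.
  apply: (@eq_poly_away _ (r * curve_poly h p1)).
    rewrite mulf_neq0 //; apply: contraNneq p1t => p10.
    by rewrite -(horner_curve_poly _ (hx t)) p10 horner0.
  move=> u; rewrite hornerM mulf_eq0 negb_or => /andP[ru].
  rewrite !hornerM sAB // !(horner_curve_poly _ (hx u)) => /p1U[_ Q1u ->].
  by rewrite mulrAC divfK.
have /dvdpP[C AC] : B %| A.
  by apply: regular_fraction_dvdp => // t; have [P1 [Q1 []]] := loc t; exists P1, Q1.
have sizeB : size B = (e' i0).+1.
  apply/eqP; rewrite eqn_leq sB /=; apply: contraT; rewrite -ltnNge ltnS => sB'.
  by rewrite -Btop nth_default ?eqxx in Qoo.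
have /size1_polyC CE : (size C <= 1)%N.
  have [->|C0] := eqVneq C 0; first by rewrite size_poly0.
  move: sA; rewrite AC size_mul // sizeB => sA.
  have ltee' : (e i0 <= e' i0)%N by have := ee' i0; lia.
  rewrite addnS /= in sA; rewrite -(leq_add2r (e' i0)).
  by apply: leq_trans sA _; lia.
exists C`_0 => t; have [P1 [Q1 [Q1t AQ ->]]] := loc t.
have -> : P1 = C * Q1 by apply: (mulIf B0); rewrite -AQ AC mulrAC.
by rewrite hornerM CE hornerC coefC eqxx mulfK.
Qed.

End NonpositiveDegree.

(** * Ample line bundles have positive multidegree *)

Section AmplePositive.
Variables (K : closedFieldType) (n : nat) (a : 'I_n -> nat).

Lemma very_ample_gt0 d i0 : (0 < a i0)%N -> very_ample K a d -> 0 < d i0.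
Proof.
move=> ai0 [k [phi [phis [phi_inj _ _ _]]]]; rewrite ltNge; apply/negP => d0.
(* The line is [1 : t : 0 : ... : 0] in the factor [i0], with [1 : 0 : ... : 0] in the other
   factors. *)
pose h (c : cvar a) : {poly K} := if tagged c == 0 :> nat then 1
  else if (tag c == i0) && (tagged c == 1 :> nat) then 'X else 0.
pose y t i : 'rV[K]_(a i).+1 := \row_j (h (var_at j)).[t].
have yP t i : y t i != 0.
  apply/negP => /eqP/rowP/(_ ord0); rewrite !mxE /h /= hornerC => /eqP.
  by rewrite oner_eq0.
(* The point at infinity of this line: [0 : 1 : 0 : ... : 0] in the factor [i0], unchanged
   elsewhere. *)
pose yoo i : 'rV[K]_(a i).+1 := \row_j ((j == (i == i0) :> nat)%:R).
have yooP i : yoo i != 0.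
  have lti : ((i == i0) < (a i).+1)%N by case: eqP => [->|].
  apply/negP => /eqP/rowP/(_ (Ordinal lti)); rewrite !mxE /= eqxx => /eqP.
  by rewrite oner_eq0.
pose x t := HCoords (yP t); pose xoo := HCoords yooP.
have hx t c : hcoord (x t) c = (h c).[t].
  by case: c => i j; rewrite /hcoord mxE.
have hoo c : degree_top (tag c == i0) (hcoord xoo c) (h c).
  case: c => i j; rewrite /hcoord /h mxE /=.
  case: eqVneq => [_|]; case: (nat_of_ord j) => [|[|m]] //=; split;
    by rewrite ?size_poly1 ?size_polyX ?size_poly0 ?coef1 ?coefX ?coef0.
have phi_const t : phi (x t) ord0 = phi (x 0) ord0.
  apply/rowP => j.
  by have [c cE] := section_curve_const hx hoo (phis j) d0; rewrite !cE.
have /phi_inj/(_ i0)[c c0 /rowP xc] : same_point (phi (x 0)) (phi (x 1)).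
  by move=> i; exists 1; rewrite ?oner_neq0 // scale1r (ord1 i) phi_const.
have lt1a : (1 < (a i0).+1)%N by [].
have := xc (Ordinal lt1a); rewrite !mxE /h /= eqxx /= !hornerX mulr0.
by move/eqP; rewrite oner_eq0.
Qed.

Lemma ample_gt0 d i : (0 < a i)%N -> ample K a d -> 0 < d i.
Proof.
move=> ai [m m0 /(very_ample_gt0 ai)].
by rewrite pmulrn_lgt0.
Qed.

End AmplePositive.

(** * The Segre-Veronese embedding: positive multidegrees are very ample *)

Section SegreVeronese.
Variables (K : closedFieldType) (n : nat) (a E : 'I_n -> nat).
Implicit Types (x y : hcoords K a).

(* Choosing, for each i, a sequence of E_i + 1 coordinates of the i-th factor
   gives a monomial of multidegree (E_i + 1)_i, each of these being obtained
   possibly several times. *)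
Notation word := {dffun forall p : cvar E, 'I_(a (tag p)).+1}.
Implicit Types (J L : word).

Definition word_eval x J : K := \prod_p hcoord x (var_at (J p)).

Definition word_poly J : coordring K a := \prod_p coordvar K (var_at (J p)).

Definition word_set J (p : cvar E) (j : 'I_(a (tag p)).+1) : word :=
  [ffun q => @dfwith _ (fun q : cvar E => 'I_(a (tag q)).+1) J p j q].

Definition word_rest x J (p : cvar E) : K :=
  \prod_(q | q != p) hcoord x (var_at (J q)).

Lemma word_evalE x J p :
  word_eval x J = hcoord x (var_at (J p)) * word_rest x J p.
Proof. by rewrite /word_eval (bigD1 p). Qed.

Lemma word_eval_set x J p j :
  word_eval x (@word_set J p j) = hcoord x (var_at j) * word_rest x J p.
Proof.
rewrite (word_evalE _ _ p) ffunE dfwith_in; congr (_ * _).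
by apply: eq_bigr => q qp; rewrite ffunE dfwith_out // eq_sym.
Qed.

Lemma evalp_word x J : evalp (word_poly J) x = word_eval x J.
Proof. by rewrite evalp_prod; apply: eq_bigr => p _; rewrite evalp_var. Qed.

Lemma sum_tag_eq i : (\sum_(p : cvar E) (tag p == i) = (E i).+1)%N.
Proof.
transitivity (\sum_k \sum_(l < (E k).+1) (k == i))%N.
  by rewrite sig_big_dep.
rewrite (bigD1 i) //= [X in (_ + X)%N]big1 ?addn0 => [|k /negPf ->].
  by rewrite eqxx sum1_card card_ord.
by rewrite big1.
Qed.

Lemma mhomog_word J : mhomog (fun i => (E i).+1) (word_poly J).
Proof.
have hJ p : mhomog (fun i => tag p == i : nat) (coordvar K (var_at (J p))).
  exact: mhomog_var.
apply: mhomog_ext (mhomog_prod hJ) => i; exact: sum_tag_eq.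
Qed.

Lemma word_eval_neq0 x : exists J, word_eval x J != 0.
Proof.
have j i : {j | x i 0 j != 0} by apply/sigW/hcoords_coord_neq0.
exists [ffun p => sval (j (tag p))]; apply/prodf_neq0 => p _.
by rewrite ffunE; apply: svalP (j (tag p)).
Qed.

(** The ambient space has one coordinate more than there are words; the surplus last index falls on
    the default of [nth] and repeats the word of letters [ord0]. *)
Definition word_of (j : 'I_#|{: word}|.+1) : word :=
  nth [ffun=> ord0] (enum {: word}) j.

Definition index_of J : 'I_#|{: word}|.+1 := inord (index J (enum {: word})).

Lemma index_ofK : cancel index_of word_of.
Proof.
have ltJ J : (index J (enum {: word}) < #|{: word}|.+1)%N.
  by rewrite ltnS cardE index_size.
move=> J; rewrite /word_of /index_of inordK; last exact: ltJ.
by apply: nth_index; rewrite mem_enum.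
Qed.

Definition veronese_coord x (i : 'I_1) : 'rV[K]_#|{: word}|.+1 :=
  \row_j word_eval x (word_of j).

Lemma veronese_coord_neq0 x i : veronese_coord x i != 0.
Proof.
have [J xJ] := word_eval_neq0 x; apply: contraNneq xJ => /rowP/(_ (index_of J)).
by rewrite !mxE index_ofK => ->.
Qed.

Definition veronese x : projspace K #|{: word}| :=
  HCoords (veronese_coord_neq0 x).

Notation target := (fun _ : 'I_1 => #|{: word}|).

Definition target_var (j : 'I_#|{: word}|.+1) : coordring K target :=
  coordvar K (var_at (a := target) (i := ord0) j).

Lemma mhomog_target_var j : mhomog (fun=> 1%N) (target_var j).
Proof.
by apply: mhomog_ext (@mhomog_var K _ _ _) => i; rewrite (ord1 i).
Qed.

Lemma evalp_target_var j (z : projspace K #|{: word}|) :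
  evalp (target_var j) z = z ord0 0 j.
Proof. exact: evalp_var. Qed.

Lemma veroneseE x i j : veronese x i 0 j = word_eval x (word_of j).
Proof. by rewrite mxE. Qed.

Definition liftable r (f : hcoords K a -> K) :=
  exists2 F : coordring K target, mhomog (fun=> r) F
    & forall x, evalp F (veronese x) = f x.

Lemma liftable_ext r f g : f =1 g -> liftable r f -> liftable r g.
Proof. by move=> fg [F hF Ff]; exists F => // x; rewrite Ff. Qed.

Lemma liftableM r s f g :
  liftable r f -> liftable s g -> liftable (r + s) (fun x => f x * g x).
Proof.
move=> [F hF Ff] [G hG Gg]; exists (F * G); first exact: mhomogM.
by move=> x; rewrite evalpM Ff Gg.
Qed.

Lemma liftable_sum r (I : eqType) (t : seq I) (k : I -> K)
    (f : I -> hcoords K a -> K) :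
  (forall i, i \in t -> liftable r (f i)) ->
  liftable r (fun x => \sum_(i <- t) k i * f i x).
Proof.
elim: t => [|i t IHt] ft.
  by exists 0 => [|x]; [apply: mhomog0 | rewrite evalp0 big_nil].
have [F hF Ff] := ft i (mem_head _ _).
have [|G hG Gg] := IHt; first by move=> j jt; apply: ft; rewrite inE jt orbT.
exists (k i *: F + G); first by apply: mhomogD => //; apply: mhomogZ.
by move=> x; rewrite evalpD evalpZ Ff Gg big_cons.
Qed.

Lemma liftable_word J : liftable 1 (fun x => word_eval x J).
Proof.
exists (target_var (index_of J)); first exact: mhomog_target_var.
by move=> x; rewrite evalp_target_var veroneseE index_ofK.
Qed.

Definition monomial_eval x (m : 'X_{1..#|cvar a|}) : K :=
  \prod_c hcoord x c ^+ m (enum_rank c).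

Lemma degin_var m i : (0 < degin m i)%N -> exists c : cvar a,
  [/\ tag c = i,
      forall x, monomial_eval x m =
        hcoord x c * monomial_eval x (m - U_(enum_rank c))%MM
    & forall i', degin m i' =
        ((i == i') + degin (m - U_(enum_rank c))%MM i')%N].
Proof.
rewrite /degin (reindex_cvar _ (fun c => tag c == i)) lt0n sum_nat_eq0.
case/forallPn => c; rewrite negb_imply => /andP[/eqP ci mc].
have le_cm : (U_(enum_rank c) <= m)%MM by rewrite lep1mP.
exists c; split=> // [x|i'].
  rewrite -{1}(submK le_cm) addmC /monomial_eval.
  rewrite (eq_bigr (fun c' => hcoord x c' ^+ U_(enum_rank c)%MM (enum_rank c') *
    hcoord x c' ^+ (m - U_(enum_rank c))%MM (enum_rank c'))); last first.
    by move=> c' _; rewrite mnmDE exprD.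
  rewrite big_split /= (bigD1 c) //= mnm1E eqxx expr1 big1 ?mulr1 // => c' c'c.
  by rewrite mnm1E (inj_eq enum_rank_inj) [c == _]eq_sym (negPf c'c).
rewrite -{1}(submK le_cm) addmC.
rewrite (eq_bigr (fun k => U_(enum_rank c)%MM k + (m - U_(enum_rank c))%MM k)%N);
  last by move=> k _; rewrite mnmDE.
rewrite big_split /=; congr (_ + _)%N.
have := @mhomog_var K n a c U_(enum_rank c)%MM.
by rewrite msuppX inE eqxx => /(_ isT) ->; rewrite ci.
Qed.

(** Greedy extraction: every position in [s] takes a remaining variable of its own factor. Letters
    outside [s] are arbitrary, and [uniq s] ensures that setting a letter leaves the earlier ones
    intact. *)
Lemma monomial_extract (s : seq (cvar E)) m : uniq s ->
  (forall i, (\sum_(p <- s) (tag p == i) <= degin m i)%N) ->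
  exists J m',
    (forall x, monomial_eval x m =
       (\prod_(p <- s) hcoord x (var_at (J p))) * monomial_eval x m') /\
    (forall i, degin m i = (\sum_(p <- s) (tag p == i) + degin m' i)%N).
Proof.
elim: s => [|p s IHs] /= => [_ _|/andP[ps us] les].
  by exists [ffun=> ord0], m; split=> [x|i]; rewrite big_nil ?mul1r.
have [|J [m1 [mJ dm]]] := IHs us.
  by move=> i; apply: leq_trans (les i); rewrite big_cons leq_addl.
have /degin_var[c [cp m1c dm1]] : (0 < degin m1 (tag p))%N.
  by have := les (tag p); rewrite big_cons eqxx dm addnC leq_add2l.
case: c cp m1c dm1 => i j /= ip m1c dm1.
move: ip j m1c dm1 => -> j m1c dm1.
exists (word_set J (p := p) j), (m1 - U_(enum_rank (var_at (i := tag p) j)))%MM.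
split=> [x|i']; last by rewrite big_cons dm dm1 addnCA addnA.
rewrite mJ m1c big_cons ffunE dfwith_in mulrCA mulrA; congr (_ * _ * _).
rewrite big_seq [RHS]big_seq; apply: eq_bigr => q qs.
by rewrite ffunE dfwith_out //; apply: contraNneq ps => ->.
Qed.

(** Such a monomial is a product of [r] words, extracted one at a time, and each word is an ambient
    coordinate. *)
Lemma liftable_monomial r m : (forall i, degin m i = (r * (E i).+1)%N) ->
  liftable r (fun x => monomial_eval x m).
Proof.
elim: r m => [|r IHr] m dm.
  exists 1; first exact: mhomog1.
  move=> x; rewrite evalp1 /monomial_eval big1 // => c _.
  have /eqP := dm (tag c).
  rewrite /degin (reindex_cvar _ (fun c' => tag c' == tag c)).
  by rewrite sum_nat_eq0 => /forallP/(_ c); rewrite eqxx => /eqP ->.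
have [|J [m' [mJ dJ]]] :=
  @monomial_extract (index_enum (cvar E)) m (index_enum_uniq _).
  by move=> i; rewrite sum_tag_eq dm mulSn leq_addr.
apply: (@liftable_ext _ (fun x => word_eval x J * monomial_eval x m')) => //.
apply: (liftableM (r := 1)); first exact: liftable_word.
apply: IHr => i; have := dJ i; rewrite dm sum_tag_eq mulSn; lia.
Qed.

Lemma liftable_poly r (p : coordring K a) :
  mhomog (fun i => r * (E i).+1)%N p -> liftable r (evalp p).
Proof.
move=> hp; apply: (@liftable_ext _
  (fun x => \sum_(m <- msupp p) p@_m * monomial_eval x m)).
  by move=> x; rewrite evalpE.
by apply: liftable_sum => m /hp hm; apply: liftable_monomial.
Qed.

(** A monomial [M] nonzero at [x] fills the multidegree up to a multiple of that of the words. The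
    same [M] serves all [p] of multidegree [e], so the numerator and denominator of a fraction can
    be lifted together. *)
Lemma liftable_multiple (e : 'I_n -> nat) x : exists r M,
  evalp M x != 0 /\
  forall p, mhomog e p -> liftable r (fun y => evalp p y * evalp M y).
Proof.
pose r := (\sum_i e i)%N.
have er i : (e i <= r * (E i).+1)%N.
  by apply: leq_trans (leq_pmulr _ _) => //; rewrite /r (bigD1 i) //= leq_addr.
have [M hM Mx] := ne0_monomial (fun i => r * (E i).+1 - e i)%N x.
exists r, M; split=> // p hp.
apply: (@liftable_ext _ (evalp (p * M))) => [y|]; first exact: evalpM.
by apply: liftable_poly; apply: mhomog_ext (mhomogM hp hM) => i; rewrite subnKC.
Qed.

(** Vary one letter of a word [L] that is nonzero at [x]: the resulting coordinates are those of [x]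
    on one factor, times a common nonzero scalar. The same word works for [y]. *)
Lemma veronese_inj x y : same_point (veronese x) (veronese y) -> same_point x y.
Proof.
move=> /(_ ord0)[c c0 /rowP xy].
have yx J : word_eval y J = c * word_eval x J.
  by have := xy (index_of J); rewrite !mxE index_ofK.
have [L xL] := word_eval_neq0 x.
have yL : word_eval y L != 0 by rewrite yx mulf_neq0.
move=> i; pose p : cvar E := Tagged _ (ord0 : 'I_(E i).+1).
move: xL yL; rewrite !(word_evalE _ _ p) !mulf_eq0 !negb_or.
move=> /andP[_ rx] /andP[_ ry].
exists (c * word_rest x L p / word_rest y L p); first by rewrite !mulf_neq0 ?invr_neq0.
apply/rowP => j; rewrite !mxE; apply: (mulIf ry).
have := yx (word_set L (p := p) j); rewrite !word_eval_set.
rewrite -[_ / _ * _ * _]mulrAC divfK // mulrAC -mulrA => <-.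
by [].
Qed.

Lemma same_point_sym m (b : 'I_m -> nat) (x y : hcoords K b) :
  same_point x y -> same_point y x.
Proof.
move=> xy i; have [c c0 ->] := xy i; exists c^-1; first by rewrite invr_eq0.
by rewrite scalerA mulVf ?scale1r.
Qed.

Lemma veronese_image_closed :
  zariski_closed (fun z : projspace K #|{: word}| =>
    exists x, same_point (veronese x) z).
Proof.
exists (fun F => exists2 e, mhomog e F & forall x, evalp F (veronese x) = 0).
split=> [F [e hF _]|z]; first by exists e.
split=> [[x xz] F [e hF F0]|zF].
  apply/eqP; apply: contraT => /(evalp_same_point hF (same_point_sym xz)).
  by rewrite F0 eqxx.
(* Quadrics of the first kind and hypersurfaces of the second kind below
   suffice to recover a preimage of z, whose coordinates on the i-th factor are
   those of z at the words differing from L at most in p0 i. *)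
have [j0 zj0] := hcoords_coord_neq0 z ord0.
pose L := word_of j0.
pose p0 i : cvar E := Tagged _ (ord0 : 'I_(E i).+1).
pose W i j := target_var (index_of (word_set L (p := p0 i) j)).
pose w i (j : 'I_(a i).+1) := evalp (W i j) z.
have WE x i j : evalp (W i j) (veronese x) = hcoord x (var_at j) * word_rest x L (p0 i).
  by rewrite evalp_target_var veroneseE index_ofK word_eval_set.
(* Exchanging the letters of [L] at [p] and at [p0 (tag p)] between two copies of [L] gives a
   quadric relation whose other side is the square of the nonzero coordinate [z ord0 0 j0]. *)
have Lneq0 p : w (tag p) (L p) != 0.
  pose G := target_var (index_of (word_set L (p := p) (L (p0 (tag p))))).
  have /eqP : evalp (W (tag p) (L p) * G - target_var j0 * target_var j0) z = 0.
    apply: zF; exists (fun=> 1 + 1)%N.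
      by apply: mhomogB; apply: mhomogM; apply: mhomog_target_var.
    move=> x; rewrite evalpB !evalpM WE !evalp_target_var !veroneseE.
    rewrite index_ofK word_eval_set.
    rewrite {1}(word_evalE _ (word_of j0) p) (word_evalE _ (word_of j0) (p0 (tag p))).
    by rewrite -/L; ring.
  rewrite evalpB !evalpM evalp_target_var subr_eq0 => wG.
  apply: contraNneq (mulf_neq0 zj0 zj0) => w0.
  by rewrite -(eqP wG) -/(w _ _) w0 mul0r.
(* On the image, both sides are the word [word_of j] times the word [L] times all the [word_rest]
   factors. At [z] the relation makes each coordinate proportional to the corresponding word in the
   recovered coordinates [w]. *)
have wJ j : z ord0 0 j * \prod_p w (tag p) (L p) =
    z ord0 0 j0 * \prod_p w (tag p) (word_of j p).
  have /eqP : evalp (target_var j * \prod_p W (tag p) (L p) -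
      target_var j0 * \prod_p W (tag p) (word_of j p)) z = 0.
    apply: zF; exists (fun=> 1 + \sum_(p : cvar E) 1)%N.
      apply: mhomogB; (apply: mhomogM; first exact: mhomog_target_var);
        by apply: mhomog_prod => p; apply: mhomog_target_var.
    move=> x; rewrite evalpB !evalpM !evalp_prod !evalp_target_var !veroneseE.
    rewrite (eq_bigr _ (fun p _ => WE x (tag p) (L p))).
    rewrite (eq_bigr _ (fun p _ => WE x (tag p) (word_of j p))) !big_split /=.
    by rewrite -/L -/(word_eval x L) -/(word_eval x (word_of j)); ring.
  by rewrite evalpB !evalpM !evalp_prod !evalp_target_var subr_eq0 => /eqP.
have wn0 : \prod_p w (tag p) (L p) != 0 by apply/prodf_neq0 => p _.
pose x0 i : 'rV[K]_(a i).+1 := \row_j w i j.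
have x0P i : x0 i != 0.
  apply: contraNneq (Lneq0 (p0 i)) => /rowP/(_ (L (p0 i))).
  by rewrite !mxE => ->.
exists (HCoords x0P) => i; rewrite (ord1 i).
exists (z ord0 0 j0 / \prod_p w (tag p) (L p)); first by rewrite mulf_neq0 ?invr_neq0.
apply/rowP => j; apply: (mulIf wn0); rewrite wJ !mxE mulrAC divfK //.
by congr (_ * _); apply: eq_bigr => p _; rewrite /hcoord /= mxE.
Qed.

(** The complement of [V] is cut out by the forms that pull back to multiples of equations of the
    complement of [U]. For each equation, [liftable_multiple] gives a multiple whose cofactor is
    nonzero at the given point. *)
Lemma veronese_open (U : hcoords K a -> Prop) : zariski_open U ->
  exists2 V : projspace K #|{: word}| -> Prop,
    zariski_open V & forall x, U x <-> V (veronese x).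
Proof.
move=> [Z [S [homS ZS]] UZ].
pose T (F : coordring K target) := (exists e, mhomog e F) /\ exists p M, S p /\
  forall x, evalp F (veronese x) = evalp p x * evalp M x.
exists (fun z => ~ forall F, T F -> evalp F z = 0).
  by exists (fun z => forall F, T F -> evalp F z = 0) => //; exists T; split=> // F [].
move=> x; rewrite UZ; split=> nZ.
  move=> T0; apply: nZ; apply/ZS => p Sp; have [e hp] := homS p Sp.
  have [r [M [Mx /(_ p hp)[F hF FpM]]]] := liftable_multiple e x.
  have /eqP : evalp F (veronese x) = 0.
    by apply: T0; split; [exists (fun=> r) | exists p, M].
  by rewrite FpM mulf_eq0 (negPf Mx) orbF => /eqP.
move=> /ZS S0; apply: nZ => F [_ [p [M [Sp ->]]]].
by rewrite S0 // mul0r.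
Qed.

Lemma veronese_lift_regular (V : projspace K #|{: word}| -> Prop)
    (h : hcoords K a -> K) z :
  zariski_open V -> is_section (fun=> 0) (fun x => V (veronese x)) h -> V z ->
  exists (V' : projspace K #|{: word}| -> Prop) (g : projspace K #|{: word}| -> K),
    [/\ zariski_open V', V' z, forall w, V' w -> V w,
        is_section (fun=> 0) V' g
      & forall x, V' (veronese x) -> h x = g (veronese x)].
Proof.
move=> oV hV Vz.
(* Off the closed image the condition on [g] is vacuous, and the zero function will do. *)
have [[x xz]|nz] := classic (exists x, same_point (veronese x) z); last first.
  pose C z := ~ exists x, same_point (veronese x) z.
  have oC : zariski_open C.
    exists (fun z => exists x, same_point (veronese x) z) => //.
    exact: veronese_image_closed.
  exists (fun w => V w /\ C w), (fun=> 0); split=> //; first exact: openI.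
  - by move=> w [].
  - exact/section0/openI.
  move=> x [_ []]; exists x => i; exists 1; first exact: oner_neq0.
  by rewrite scale1r.
have Vx : V (veronese x) by apply: open_same_point (same_point_sym xz) Vz.
(* In degree 0, [P] and [Q] have the same multidegree, so both lift after multiplication by one [M],
   which cancels in the quotient. *)
have [e [e' [P [Q [W [[hP hQ ee'] [oW Wx WV hW]]]]]]] := hV x Vx.
have [r [M [Mx liftM]]] := liftable_multiple e x.
have [F hF FP] := liftM P hP.
have [|G hG GQ] := liftM Q.
  by apply: mhomog_ext hQ => i; have := ee' i; lia.
have [W2 oW2 WW2] := veronese_open oW.
have Gx : evalp G (veronese x) != 0 by rewrite GQ mulf_neq0 // (hW x Wx).1.
have oV' := openI (openI oV oW2) (open_ne0 hG).
exists (fun w => (V w /\ W2 w) /\ evalp G w != 0), (fun w => evalp F w / evalp G w).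
split=> //.
- by apply: open_same_point oV' xz _; split=> //; split=> //; apply/WW2.
- by move=> w [[]].
- move=> w V'w; exists (fun=> r), (fun=> r), F, G; eexists; split.
    by split=> // i; rewrite subrr.
  by split; [exact: oV' | exact: V'w | | move=> y []].
move=> y [[_ /WW2/hW[Qy ->]]]; rewrite GQ FP mulf_eq0 negb_or => /andP[_ My].
by rewrite -mulf_div divff // mulr1.
Qed.

Lemma veronese_very_ample : very_ample K a (fun i => (E i).+1%:Z).
Proof.
exists #|{: word}|, veronese; split.
  move=> j; have hj := @mhomog_word (word_of j).
  apply: section_ext (section_poly (@openT K n a) hj) => //.
  by move=> x _; rewrite evalp_word veroneseE.
split; [exact: veronese_inj | exact: veronese_image_closed | |].
  exact: veronese_open.
exact: veronese_lift_regular.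
Qed.

End SegreVeronese.

Lemma very_ample_pos (K : closedFieldType) n (a : 'I_n -> nat) (d : 'I_n -> int) :
  (forall i, 0 < d i) -> very_ample K a d.
Proof.
(* Words have multidegree [(E i).+1], hence the predecessor. *)
move=> d0; have [k [phi [phis cl]]] :=
  @veronese_very_ample K n a (fun i => `|d i|%N.-1).
exists k, phi; split=> // j; apply: section_ext (phis j) => // i.
by have := d0 i; lia.
Qed.

(** * Toeplitz matrices *)

Section Toeplitz.
Variable K : fieldType.

Definition toeplitz (c : nat -> K) g m : 'M_(g, m) :=
  \matrix_(i, j) if (i <= j)%N then c (j - i)%N else 0.

(** Let [l] be the least index with [c l] nonzero. In column [r + l], the rows above [r] drop out by
    induction on [r] and the rows below by minimality of [l], leaving the product of the r-th entry
    of [v] with [c l]. *)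
Lemma toeplitz_lker c g m k (v : 'rV_g) : c k != 0 -> (g + k <= m)%N ->
  v *m toeplitz c g m = 0 -> v = 0.
Proof.
move=> ck gkm vT.
have exc : exists k, c k != 0 by exists k.
case: (ex_minnP exc) => l cl lmin {exc}.
have gl : (g + l <= m)%N by apply: leq_trans gkm; rewrite leq_add2l lmin.
suff v0 r (ltrg : (r < g)%N) : v 0 (Ordinal ltrg) = 0.
  by apply/rowP => -[r ltrg]; rewrite v0 mxE.
elim/ltn_ind: r ltrg => r IHr ltrg.
have ltrm : (r + l < m)%N by apply: leq_trans gl; rewrite ltn_add2r.
have /eqP := congr1 (fun u : 'rV_m => u 0 (Ordinal ltrm)) vT.
rewrite !mxE (bigD1 (Ordinal ltrg)) //= big1 => [|[i ltig] /= ir].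
  by rewrite mxE /= leq_addr addKn addr0 mulf_eq0 (negPf cl) orbF => /eqP.
have [ltir|leri] := ltnP i r; first by rewrite IHr // mul0r.
have {ir}ltri : (r < i)%N by rewrite ltn_neqAle leri andbT eq_sym.
rewrite mxE /=; case: ifP => [leirl|]; last by rewrite mulr0.
have [-> |/lmin] := eqVneq (c (r + l - i)%N) 0; [exact: mulr0 | lia].
Qed.

Lemma toeplitz_truncate c g m m' :
  toeplitz c g (m + m') *m col_mx 1%:M 0 = toeplitz c g m.
Proof.
rewrite -[toeplitz c g (m + m')]hsubmxK mul_row_col mulmx1 mulmx0 addr0.
by apply/matrixP => i j; rewrite !mxE.
Qed.

End Toeplitz.

(** * Assembling linear monads from blocks *)

Section LinearMonads.
Variables (K : closedFieldType) (n : nat) (a : 'I_n -> nat) (d : 'I_n -> int).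

Lemma row_mx_section m q r (A : hcoords K a -> 'M[K]_(m, q))
    (B : hcoords K a -> 'M[K]_(m, r)) :
  (forall i j, global_section d (fun x => A x i j)) ->
  (forall i j, global_section d (fun x => B x i j)) ->
  forall i j, global_section d (fun x => row_mx (A x) (B x) i j).
Proof.
move=> As Bs i j; case: (split_ordP j) => k ->.
  by apply: section_ext (As i k) => // x _; rewrite row_mxEl.
by apply: section_ext (Bs i k) => // x _; rewrite row_mxEr.
Qed.

Lemma col_mx_section m q r (A : hcoords K a -> 'M[K]_(q, m))
    (B : hcoords K a -> 'M[K]_(r, m)) :
  (forall i j, global_section d (fun x => A x i j)) ->
  (forall i j, global_section d (fun x => B x i j)) ->
  forall i j, global_section d (fun x => col_mx (A x) (B x) i j).
Proof.
move=> As Bs i j; case: (split_ordP i) => k ->.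
  by apply: section_ext (As k j) => // x _; rewrite col_mxEu.
by apply: section_ext (Bs k j) => // x _; rewrite col_mxEd.
Qed.

Lemma scale_const_section m r (s : hcoords K a -> K) (A : 'M[K]_(m, r)) :
  global_section d s ->
  forall i j, global_section d (fun x => (s x *: A) i j).
Proof.
move=> ss i j.
apply: section_ext (section0M (section_const (A i j) (@openT K n a)) ss) => //.
by move=> x _; rewrite mxE mulrC.
Qed.

Lemma zero_section m r i j :
  global_section d (fun x : hcoords K a => (0 : 'M[K]_(m, r)) i j).
Proof.
by apply: section_ext (section0 d (@openT K n a)) => // x _; rewrite mxE.
Qed.

Lemma toeplitz_section (c : nat -> hcoords K a -> K) g m :
  (forall k, global_section d (c k)) ->
  forall i j, global_section d (fun x => toeplitz (c^~ x) g m i j).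
Proof.
move=> cs i j; have [le_ij|lt_ji] := leqP i j.
  by apply: section_ext (cs (j - i)%N) => // x _; rewrite mxE le_ij.
apply: section_ext (section0 d (@openT K n a)) => // x _.
by rewrite mxE leqNgt lt_ji.
Qed.

(** Common form of the two cases: the identity block scaled by [s] makes the left map injective
    where [s] is nonzero, and the [l] zero rows below it absorb the excess rank of the middle
    term. *)
Lemma linear_monad_block (q r g l : nat) (s : hcoords K a -> K) z
    (A : hcoords K a -> 'M[K]_(q, r)) (B : hcoords K a -> 'M[K]_(g, q))
    (C : hcoords K a -> 'M[K]_(g, r + l)) :
  (forall i, 0 < d i) -> global_section d s -> s z != 0 ->
  (forall i j, global_section d (fun x => A x i j)) ->
  (forall i j, global_section d (fun x => B x i j)) ->
  (forall i j, global_section d (fun x => C x i j)) ->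
  (forall x, row_free (row_mx (B x) (C x))) ->
  (forall x, B x *m A x + s x *: (C x *m col_mx 1%:M 0) = 0) ->
  linear_monad d (fun x => col_mx (A x) (s x *: col_mx 1%:M 0))
    (fun x => row_mx (B x) (C x)).
Proof.
move=> d0 ss sz As Bs Cs BCfree BA.
have cols := col_mx_section As (scale_const_section (col_mx 1%:M 0) ss).
have rows := row_mx_section Bs Cs.
split=> //; first exact: very_ample_pos.
split.
- by apply: (@mxmap_morphism _ _ _ d) => // i; rewrite addrN.
- by apply: (@mxmap_morphism _ _ _ d) => // i; rewrite addr0.
- move=> U t _ _ x _; rewrite /mxmap mulmxA mul_row_col -scalemxAr BA.
  exact: mul0mx.
- apply: (mxmap_injective ss sz) => x v.
  move=> /(congr1 (usubmx \o dsubmx)) /=.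
  rewrite mul_col_mx -scalemxAl mul_col_mx mul1mx col_mxKd scale_col_mx col_mxKu.
  by rewrite !linear0.
exact: mxmap_surjective.
Qed.

(** The basis is extended by zero beyond [N] to serve as a Toeplitz sequence. Freeness makes its
    first element nonzero somewhere; a monomial nonzero at [x] lies in its span, so some element is
    nonzero at [x]. *)
Lemma h0_base_point_free N : (forall i, 0 < d i) -> is_h0 K a d N.+1 ->
  exists c : nat -> hcoords K a -> K,
    [/\ forall k, global_section d (c k),
        exists z, c 0%N z != 0
      & forall x, exists2 k, (k <= N)%N & c k x != 0].
Proof.
move=> d0 [b [bs bfree bspan]].
exists (fun k x => if (k <= N)%N then b (inord k) x else 0); split.
- by move=> k; case: (k <= N)%N; [exact: bs | exact/section0/openT].
- apply: NNPP => /not_ex_all_not b0.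
  have b00 x : b ord0 x = 0.
    have := b0 x; rewrite /= -[X in inord X]/(nat_of_ord (@ord0 N)) inord_val.
    by move/negP/negPn/eqP.
  have /eqP : (ord0 == ord0 :> 'I_N.+1)%:R = 0 :> K.
    apply: (bfree (fun i => (i == ord0)%:R)) => x.
    by rewrite big1 // => i _; case: eqP => [->|_]; rewrite ?b00 ?mulr0 ?mul0r.
  by rewrite oner_eq0.
move=> x.
have [M hM Mx] := ne0_monomial (fun i => `|d i|%N) x.
have Ms : global_section d (evalp M).
  apply: section_ext (section_poly (@openT K n a) hM) => // i.
  by have := d0 i; lia.
have [u Mu] := bspan _ Ms.
have [i /= bi|b0] := pickP (fun i => b i x != 0).
  by exists i; rewrite -ltnS ?ltn_ord // inord_val.
case/eqP: Mx; rewrite Mu big1 // => i _.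
by have /eqP -> := negbFE (b0 i); rewrite mulr0.
Qed.

End LinearMonads.

(* The monads in the two numerical ranges *)
Local Close Scope ring_scope.

Theorem theorem4p1 (R : realType) (n : nat) (a : 'I_n -> nat) (d : 'I_n -> int)
  (N alpha beta gamma : nat)
  (n_gt0 : 0 < n) (a_gt0 : forall i, 0 < a i)
  (ampleL : ample (complex R) a d)
  (h0L : is_h0 (complex R) a d N.+1)
  (alpha_gt0 : 0 < alpha) (beta_gt0 : 0 < beta) (gamma_gt0 : 0 < gamma)
  (cond : (2 * gamma + N - 1 <= beta /\ alpha + gamma <= beta)
          \/ alpha + gamma + N <= beta) :
  exists (f : hcoords (complex R) a -> 'M[complex R]_(beta, alpha))
         (g : hcoords (complex R) a -> 'M[complex R]_(gamma, beta)),
    linear_monad d f g.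
Proof.
have d_gt0 i : (0 < d i)%R by apply: ample_gt0 ampleL.
have [c [cs [z c0z] cbpf]] := h0_base_point_free d_gt0 h0L.
case: cond => [[le_beta le_ag]|le_beta].
  have [l betaE] : exists l, beta = gamma + (alpha + l).
    by exists (beta - gamma - alpha); lia.
  subst beta; pose T x m := toeplitz (fun k => c k.+1 x) gamma m.
  exists (fun x => col_mx (- T x alpha) (c 0 x *: col_mx 1%:M 0))%R.
  exists (fun x => row_mx (c 0 x)%:M (T x (alpha + l)))%R.
  apply: (linear_monad_block d_gt0 (cs 0) c0z).
  - have Ns k : global_section d (fun x => (- 1 * c k.+1 x)%R).
      by apply: section0M (cs _); apply/section_const/openT.
    move=> i j; apply: section_ext (toeplitz_section Ns i j) => // x _.
    by rewrite /T !mxE; case: ifP; rewrite ?oppr0 // mulN1r.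
  - move=> i j; apply: section_ext (scale_const_section 1%:M%R (cs 0) i j) => //.
    by move=> x _; rewrite scalemx1.
  - exact: (toeplitz_section (c := fun k x => c k.+1 x)).
  - move=> x; apply: inj_row_free => v; rewrite mul_mx_row => vB.
    have := congr1 lsubmx vB; rewrite row_mxKl mul_mx_scalar linear0 => cv.
    have := congr1 rsubmx vB; rewrite row_mxKr linear0 => vT.
    (* Where [c 0] is nonzero the scalar block kills [v]. Otherwise some [c k.+1] with [k.+1 <= N]
       is nonzero, and the Toeplitz block has [beta - gamma], thus at least [gamma + N - 1],
       columns, enough for the shifted index [k]. *)
    have [k leN ck] := cbpf x; case: k => [|k] in leN ck.
      by apply/eqP; move/eqP: cv; rewrite scaler_eq0 (negPf ck).
    by apply: (toeplitz_lker ck _ vT); lia.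
  move=> x; rewrite /T toeplitz_truncate mul_scalar_mx scalerN addrC subrr //.
have [l betaE] : exists l, beta = gamma + N + (alpha + l).
  by exists (beta - gamma - N - alpha); lia.
subst beta.
(* The nonzero rows of this matrix face the zero columns of the next one, so the composite
   vanishes. *)
exists (fun x => col_mx 0 (c 0 x *: col_mx 1%:M 0))%R.
exists (fun x => row_mx (toeplitz (c^~ x) gamma (gamma + N)) 0)%R.
apply: (linear_monad_block d_gt0 (cs 0) c0z).
- exact: zero_section.
- exact: toeplitz_section.
- exact: zero_section.
- move=> x; apply: inj_row_free => v; rewrite mul_mx_row => /(congr1 lsubmx).
  rewrite row_mxKl linear0 => vT.
  have [k leN ck] := cbpf x.
  by apply: (toeplitz_lker ck _ vT); rewrite leq_add2l.
by move=> x; rewrite mulmx0 mul0mx scaler0 addr0.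
Qed.
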